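(* Let $Q(x,y)=ax^2+hxy+by^2$ be a binary quadratic form with integer coefficients $a,h,b$, and let $\Lambda_Q(\xi)$ and $\Lambda(\xi)$, $\xi\in\mathbb{R}P^1=\mathbb{R}\cup\{\infty\}$, be the Lyapunov exponents defined in the context. (i) If $Q$ is definite, then $\Lambda_Q(\xi)=2\Lambda(\xi)$ for all $\xi\in\mathbb{R}P^1$. (ii) If $Q$ is indefinite and does not represent zero (that is, $Q(x,y)\neq 0$ for all $(x,y)\in\mathbb{Z}^2\setminus\{(0,0)\}$), let $\alpha_{\pm}$ be the two (real, irrational) roots of the equation $Q(\xi,1)=0$. Then $$\Lambda_Q(\xi)=\begin{cases}2\Lambda(\xi) & \text{if } \xi\neq\alpha_{\pm},\\ 0 & \text{if } \xi=\alpha_{\pm}.\end{cases}$$ In other words, the only exceptional values, i.e. those $\xi\in\mathbb{R}P^1$ with $\Lambda_Q(\xi)\neq 2\Lambda(\xi)$, are the two values $\xi=\alpha_{\pm}$, and at these the growth exponent $\Lambda_Q$ is zero.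
   Context: Let $L=\begin{pmatrix}1&1\\0&1\end{pmatrix}$ and $R=\begin{pmatrix}1&0\\1&1\end{pmatrix}$. Paths and matrices. For $\xi\in[0,\infty]$ with continued fraction expansion $\xi=[c_0,c_1,c_2,\ldots]=c_0+\cfrac{1}{c_1+\cfrac{1}{c_2+\cdots}}$ ($c_0\ge 0$ and $c_i\geq 1$ for $i\ge1$, all integers), the path $\gamma_\xi$ in the planar binary rooted (Farey) tree makes $c_0$ left turns, then $c_1$ right turns, then $c_2$ left turns, and so on. The matrix $A_n(\xi)$ is the product, from left to right, of the first $n$ letters of the infinite word $L^{c_0}R^{c_1}L^{c_2}R^{c_3}\cdots$ (with $A_0=I$). If $\xi=[c_0,\ldots,c_m]\ge 0$ is rational, the word is completed to the infinite word $L^{c_0}R^{c_1}\cdots X^{c_m}Y^{\infty}$, where $\{X,Y\}=\{L,R\}$ and the letters alternate (either of the two finite continued fraction expansions of $\xi$ with admissible entries may be used). In particular, the word for $\xi=0$ is $R^\infty$, and the word for $\xi=\infty$ is $L^\infty$. For $\xi<0$ with $-\xi=[c_0,c_1,c_2,\ldots]$, the path $\gamma_\xi$ is the reflected path, and $A_n(\xi)$ is the product of the first $n$ letters of the word $(L^{-1})^{c_0}(R^{-1})^{c_1}(L^{-1})^{c_2}(R^{-1})^{c_3}\cdots$, completed in the same way for rational $\xi$. The exponent $\Lambda$. Let $\rho(A)$ denote the spectral radius of a matrix $A$ (the maximum modulus of its eigenvalues). Then $$\Lambda(\xi)=\limsup_{n\to\infty}\frac{\ln\rho(A_n(\xi))}{n}.$$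 The exponent $\Lambda_Q$. Let $u_n,v_n\in\mathbb{Z}^2$ be the first and second columns of $A_n(\xi)$. The $n$-th topographic triple $(a_n(\xi),b_n(\xi),c_n(\xi))$ of $Q$ along $\gamma_\xi$ consists of the values of $Q$ on the $n$-th superbase on the path: $a_n=Q(u_n)$, $b_n=Q(v_n)$, and $c_n=Q(u_n+v_n)$ if $\xi\in[0,\infty]$, $c_n=Q(u_n-v_n)$ if $\xi<0$. Put $|Q_n(\xi)|=\max(|a_n(\xi)|,|b_n(\xi)|,|c_n(\xi)|)$. Then $$\Lambda_Q(\xi)=\limsup_{n\to\infty}\frac{\ln|Q_n(\xi)|}{n}.$$ *)

(* Defs.v *)
From HB Require Import structures.
From mathcomp Require Import all_boot all_order all_algebra.
From mathcomp Require Import all_classical all_reals all_analysis.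
From mathcomp Require Import complex.
From mathcomp Require Import ring lra.

Set Implicit Arguments.
Unset Strict Implicit.
Unset Printing Implicit Defensive.

Import Order.TTheory GRing.Theory Num.Theory.
Import numFieldNormedType.Exports.

Local Open Scope classical_set_scope.
Local Open Scope ring_scope.

(* [Some x] is the real point x and [None] is the point at infinity. *)
Definition RP1 (R : realType) : Type := one_point_compactification R.

(* [cfval [:: c_0; ...; c_m]] is [c_0, ..., c_m]; the last step relies on
   0^-1 = 0, so that [cfval [:: c_m] = c_m]. *)
Fixpoint cfval (R : realType) (s : seq nat) : R :=
  if s is c :: s' then c%:R + (cfval R s')^-1 else 0.

Inductive turn := Left | Right.

Definition flip (t : turn) : turn := if t is Left then Right else Left.

(* [cfword t [:: c_0; ...; c_m]] is the infinite word t^c_0 t'^c_1 t^c_2 ...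
   with t' = flip t, whose last block, of length c_m, is followed by infinitely
   many copies of the opposite letter. *)
Fixpoint cfword (t : turn) (s : seq nat) (n : nat) : turn :=
  if s is c :: s' then
    if (n < c)%N then t else cfword (flip t) s' (n - c)
  else t.

(* [w] is a word describing the path to [xi]; for xi < 0 it is the word of -xi,
   the reflection being taken into account in [pathmx].  A rational xi has one
   word for each of its finite expansions.  In the infinite case the first
   n + 2 blocks contain at least n + 1 letters, hence the letter of index n. *)
Definition path_word (R : realType) (xi : RP1 R) (w : nat -> turn) : Prop :=
  match xi with
  | None => forall n, w n = Left
  | Some x =>
      (exists c0 s, [/\ all (leq 1) s,
                        cfval R (c0 :: s) = `|x|
                      & forall n, w n = cfword Left (c0 :: s) n])
      \/
      (exists c : nat -> nat,
         [/\ forall i, (0 < c i.+1)%N,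
             cfval R (mkseq c n) @[n --> \oo] --> `|x|
           & forall n, w n = cfword Left (mkseq c n.+2) n])
  end.

Definition neg_point (R : realType) (xi : RP1 R) : bool :=
  if xi is Some x then x < 0 else false.

Definition Lmx : 'M[int]_2 := \matrix_(i, j) (i <= j)%N%:R.
Definition Rmx : 'M[int]_2 := \matrix_(i, j) (j <= i)%N%:R.

Definition turnmx (t : turn) : 'M[int]_2 := if t is Left then Lmx else Rmx.

(* The ring inverse of 'M[int]_2 is the matrix inverse. *)
Definition pathmx (R : realType) (xi : RP1 R) (w : nat -> turn) (n : nat) :
    'M[int]_2 :=
  \prod_(i < n) (if neg_point xi then (turnmx (w i))^-1 else turnmx (w i)).

Definition spectral_radius (R : realType) (n : nat) (A : 'M[int]_n) : R :=
  sup [set r : R | exists2 z : R[i],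
         eigenvalue (map_mx intr A) z & r = complex.Re `|z|].

(* [path] chooses a word for every point, i.e. one of the two expansions of
   every rational number. *)
Definition Lambda (R : realType) (path : RP1 R -> nat -> turn) (xi : RP1 R) :
    \bar R :=
  limn_esup (fun n =>
    (ln (spectral_radius R (pathmx xi (path xi) n)) / n%:R)%:E).

(* a x^2 + h x y + b y^2, for x and y in any commutative ring *)
Definition qform (a h b : int) (T : comNzRingType) (x y : T) : T :=
  a%:~R * x ^+ 2 + h%:~R * x * y + b%:~R * y ^+ 2.

Definition qform_col (a h b : int) (u : 'cV[int]_2) : int :=
  qform a h b (u 0 0) (u 1 0).

Definition topo_norm (R : realType) (a h b : int) (xi : RP1 R)
    (w : nat -> turn) (n : nat) : int :=
  let u := col 0 (pathmx xi w n) in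
  let v := col 1 (pathmx xi w n) in
  let an := qform_col a h b u in
  let bn := qform_col a h b v in
  let cn := qform_col a h b (if neg_point xi then u - v else u + v) in
  Num.max `|an| (Num.max `|bn| `|cn|).

Definition Lambda_Q (R : realType) (a h b : int)
    (path : RP1 R -> nat -> turn) (xi : RP1 R) : \bar R :=
  limn_esup (fun n =>
    (ln ((topo_norm a h b xi (path xi) n)%:~R : R) / n%:R)%:E).

Definition positive_definite (R : realType) (a h b : int) : Prop :=
  forall x y : R, (x, y) != (0, 0) -> 0 < qform a h b x y.

Definition negative_definite (R : realType) (a h b : int) : Prop :=
  forall x y : R, (x, y) != (0, 0) -> qform a h b x y < 0.

Definition definite (R : realType) (a h b : int) : Prop :=
  positive_definite R a h b \/ negative_definite R a h b.

Definition indefinite (R : realType) (a h b : int) : Prop :=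
  (exists x y : R, 0 < qform a h b x y) /\
  (exists x y : R, qform a h b x y < 0).

Definition represents_zero (a h b : int) : Prop :=
  exists x y : int, (x, y) != (0, 0) /\ qform a h b x y = 0.

(* A choice of words as in [Lambda] exists: the partial quotients given by the
   Gauss map form an expansion of every nonnegative real number. *)
Section PathWordExists.
Variable R : realType.
Implicit Types (x : R) (n : nat).

Let fl x : nat := Num.truncn x.
Let gauss x : R := (x - (fl x)%:R)^-1.
Let pq x n : nat := fl (iter n gauss x).
Let noninteger_until x n := forall i, (i < n)%N -> iter i gauss x != (pq x i)%:R.

Let cfval_cons c s : cfval R (c :: s) = c%:R + (cfval R s)^-1.
Proof. by []. Qed.

Let fl_bounds x : 0 <= x -> (fl x)%:R <= x /\ x < (fl x)%:R + 1.
Proof. by move=> /truncn_itv /andP[? ?]; split=> //; rewrite natr1. Qed.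

Let gauss_gt1 x : 0 <= x -> x != (fl x)%:R -> 1 < gauss x.
Proof.
move=> /fl_bounds[le1 lt1] xN; rewrite /gauss invf_gt1 ?subr_gt0 ?lt_def ?xN //.
by lra.
Qed.

Let fl_gt0 x : 1 <= x -> (0 < fl x)%N.
Proof. by move=> x1; rewrite /fl truncn_gt0. Qed.

Let gaussK x : 0 <= x -> x = (fl x)%:R + (gauss x)^-1.
Proof. by move=> x0; rewrite /gauss invrK addrC subrK. Qed.

Let mkseq_pq x n :
  mkseq (pq x) n.+1 = fl x :: mkseq (pq (gauss x)) n.
Proof.
rewrite /mkseq /= -[1%N]addn0 iotaDl -map_comp; congr (_ :: _).
by apply: eq_map => i /=; rewrite /pq -iterSr.
Qed.

Let noninteger_tail x n :
  noninteger_until x n.+1 -> noninteger_until (gauss x) n.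
Proof. by move=> H i ltin; have := H i.+1 ltin; rewrite /pq !iterSr. Qed.

Let pq_gt0 x n i :
  0 <= x -> noninteger_until x n -> (0 < i <= n)%N -> (0 < pq x i)%N.
Proof.
elim: n x i => [|n IH] x [|i] //= x0 H; rewrite ltnS => lein.
have g1 : 1 < gauss x by apply: gauss_gt1 => //; exact: (H 0%N).
rewrite /pq iterSr; case: i lein => [_|i lein]; first exact/fl_gt0/ltW.
apply: (IH (gauss x) i.+1) => //; first by lra.
exact: noninteger_tail.
Qed.

Let finite_value x n : 0 <= x -> noninteger_until x n ->
  iter n gauss x = (pq x n)%:R -> cfval R (mkseq (pq x) n.+1) = x.
Proof.
elim: n x => [|n IH] x x0 H e.
  by rewrite mkseq_pq /= invr0 addr0 -/(pq x 0) -e.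
have g1 : 1 < gauss x by apply: gauss_gt1 => //; exact: (H 0%N).
rewrite mkseq_pq cfval_cons IH -?gaussK //; first by lra.
- exact: noninteger_tail.
- by move: e; rewrite /pq iterSr.
Qed.

Let cfval_ge0 s : 0 <= cfval R s.
Proof. by elim: s => //= c s IH; rewrite addr_ge0 // invr_ge0. Qed.

Let cfval_ge1 x n : 1 <= x -> 1 <= cfval R (mkseq (pq x) n.+1).
Proof.
move=> x1; rewrite mkseq_pq cfval_cons -[X in X <= _]addr0 lerD ?invr_ge0 ?cfval_ge0 //.
by rewrite ler1n fl_gt0.
Qed.

Let dist_step (c u v : R) : 1 <= u -> 1 <= v ->
  `|(c + u^-1) - (c + v^-1)| = `|u - v| / (u * v).
Proof.
move=> u1 v1; have -> : c + u^-1 - (c + v^-1) = (v - u) / (u * v) by field; lra.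
have uv : 0 < u * v by apply: mulr_gt0; lra.
by rewrite normrM normfV [`|u * v|]gtr0_norm // distrC.
Qed.

Let infinite_bound n x : 0 <= x ->
  (forall m, noninteger_until x m) ->
  `|x - cfval R (mkseq (pq x) n.+1)| <= 2 * 2^-1 ^+ n.
Proof.
suff: forall n x, 0 <= x -> (forall m, noninteger_until x m) ->
  `|x - cfval R (mkseq (pq x) n.+1)| <= 2 * 2^-1 ^+ n /\
  `|x - cfval R (mkseq (pq x) n.+2)| <= 2 * 2^-1 ^+ n.+1.
  by move=> H x0 xN; case: (H n x x0 xN).
have base y : 0 <= y -> `|y - cfval R (mkseq (pq y) 1)| <= 1.
  move=> y0; rewrite mkseq_pq /= invr0 addr0 ler_norml.
  by have [? ?] := fl_bounds y0; lra.
have tl y m : 0 <= y -> (forall m, noninteger_until y m) ->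
    [/\ 1 < gauss y, forall m, noninteger_until (gauss y) m,
        1 <= cfval R (mkseq (pq (gauss y)) m.+1)
      & `|y - cfval R (mkseq (pq y) m.+2)| =
        `|gauss y - cfval R (mkseq (pq (gauss y)) m.+1)|
          / (gauss y * cfval R (mkseq (pq (gauss y)) m.+1))].
  move=> y0 yN.
  have g1 : 1 < gauss y by apply: gauss_gt1 => //; exact: (yN 1%N 0%N).
  have g1' := cfval_ge1 m (ltW g1).
  split=> //; first by move=> k; exact: noninteger_tail.
  rewrite mkseq_pq cfval_cons {1}(gaussK y0) dist_step //; exact: ltW.
clear n x; elim=> [|n IH] x x0 xN.
  split; first by apply: (le_trans (base x x0)); rewrite expr0; lra.
  have [g1 gN c1 ->] := tl x 0%N x0 xN.
  have g0 : 0 <= gauss x by lra.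
  rewrite ler_pdivrMr; last by apply: mulr_gt0; lra.
  by apply: (le_trans (base _ g0)); rewrite expr1; nra.
split; first by case: (IH x x0 xN).
have [g1 gN c1 ->] := tl x n.+1 x0 xN.
have g0 : 0 <= gauss x by lra.
have [h1 hN d1 ->] := tl (gauss x) n g0 gN.
have h0 : 0 <= gauss (gauss x) by lra.
have [bd _] := IH _ h0 hN.
have gh : 2 <= gauss x * gauss (gauss x).
  have := fl_gt0 (ltW g1); rewrite -(ler1n R) => f1.
  rewrite {1}(gaussK g0) mulrDl mulVf; last by lra.
  by nra.
have cd : 2 <= cfval R (mkseq (pq (gauss x)) n.+2)
               * cfval R (mkseq (pq (gauss (gauss x))) n.+1).
  have := fl_gt0 (ltW g1); rewrite -(ler1n R) => f1.
  rewrite mkseq_pq cfval_cons mulrDl mulVf; last by lra.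
  by nra.
move: bd gh cd c1 d1 g1 h1.
set e := `|_ - _|; set c := cfval _ _; set d := cfval _ _.
set u := gauss (gauss x); set v := gauss x => bd gh cd c1 d1 g1 h1.
have e0 : 0 <= e by exact: normr_ge0.
have -> : e / (u * d) / (v * c) = e / ((v * u) * (c * d)) by field; lra.
rewrite ler_pdivrMr; last by apply: mulr_gt0; nra.
have q4 : 4 <= v * u * (c * d) by nra.
apply: (le_trans bd); rewrite !exprS.
have : 0 < 2^-1 ^+ n :> R by apply: exprn_gt0; lra.
by nra.
Qed.

Lemma path_word_exists (xi : RP1 R) : exists w, path_word xi w.
Proof.
case: xi => [x|]; last by exists (fun=> Left).
have x0 : 0 <= `|x| by exact: normr_ge0.
case: (pselect (exists n, iter n gauss `|x| == (pq `|x| n)%:R)) => [ex|nex].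
  case: (ex_minnP ex) => n /eqP e minn.
  have xN : noninteger_until `|x| n.
    by move=> i ltin; apply/negP => /minn; rewrite leqNgt ltin.
  exists (cfword Left (mkseq (pq `|x|) n.+1)); left.
  exists (pq `|x| 0), (mkseq (fun i => pq `|x| i.+1) n).
  have -> : pq `|x| 0 :: mkseq (fun i => pq `|x| i.+1) n = mkseq (pq `|x|) n.+1.
    by rewrite /mkseq /= -[1%N]addn0 iotaDl -map_comp.
  split => //; last exact: finite_value.
  apply/allP => _ /seq.mapP[i + ->]; rewrite mem_iota => /andP[_ ltin].
  exact: (pq_gt0 x0 xN).
have xN m : noninteger_until `|x| m.
  by move=> i _; apply/negP => e; apply: nex; exists i.
exists (fun n => cfword Left (mkseq (pq `|x|) n.+2) n); right.
exists (pq `|x|); split=> //.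
  by move=> i; apply: (pq_gt0 x0 (xN i.+1)); rewrite /= leqnn.
rewrite -(cvg_shiftS (fun n => cfval R (mkseq (pq `|x|) n))).
apply/cvgrPdist_le => e e0.
have g : geometric 2 (2^-1 : R) @ \oo --> (0 : R).
  by apply: cvg_geometric; rewrite ger0_norm; lra.
move/cvgrPdist_le: g => /(_ e e0); apply: filterS => n.
rewrite sub0r normrN /= => H.
apply: le_trans (infinite_bound _ x0 xN) (le_trans (ler_norm _) H).
Qed.

End PathWordExists.

(* Main.v *)
Require Import Defs.
From HB Require Import structures.
From mathcomp Require Import all_boot all_order all_algebra.
From mathcomp Require Import all_classical all_reals all_analysis.
From mathcomp Require Import complex.
From mathcomp Require Import ring lra zify.

Set Implicit Arguments.
Unset Strict Implicit.
Unset Printing Implicit Defensive.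

Import Order.TTheory GRing.Theory Num.Theory.
Import numFieldNormedType.Exports.
Local Open Scope classical_set_scope.
Local Open Scope ring_scope.

(** Reflecting the path of a negative point replaces Q(x, y) by Q(x, -y), so let
x >= 0. The n-th matrix on the path to x has nonnegative entries, rows (p, q) and
(r, s), and determinant 1; its spectral radius is of the order of its trace p + s
([spectral_radius_trace]). The point x lies between the slopes q/s and p/r of the
columns u and v ([path_encloses]), so that the errors e = p - x r and f = x s - q
are nonnegative, and the determinant gives s e + r f = 1 ([slope_error]).

If Q(x, 1) != 0 and x > 0, the form takes values of order Q(x, 1) r^2 and
Q(x, 1) s^2 on the columns, and r, s are at most of the order of the trace, which
is itself of the order of max(r, s). So the largest value on the superbase is
comparable with the square of the spectral radius, and the exponents differ by a
factor 2 ([growth_transversal]). At 0 and at infinity the matrices are R^n and L^n: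
everything grows polynomially and both exponents vanish ([growth_degenerate]).

If Q(x, 1) = 0, the main term is absent and |Q(u)| <= K r e, |Q(v)| <= K s f. The
product of these two nonzero integers is at most K^2, so both are bounded, and the
invariance of the discriminant bounds the value on u + v too: the superbase runs
along the periodic river of Q and its exponent is zero
([superbase_norm_isotropic]). The same inequalities together with |Q(u)|, |Q(v)| >= 1
give s <= K r and r <= K s. Hence each step multiplies r + s by a factor bounded
away from 1, and the exponent of the matrices is positive ([trace_isotropic]): the
roots are genuine exceptions. *)

(** * Exponential growth rates *)

Lemma limn_esup_cst (R : realType) (l : \bar R) : limn_esup (fun=> l) = l.
Proof. by apply: (cvg_limn_einf_sup _).2; exact: cvg_cst. Qed.

(** Both limits superior may be infinite, so the inequality cannot be obtained by
subtracting; it is proved on the suprema over the sets of the filter. *)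
Lemma limn_esup_le_scale (R : realType) (u v : nat -> R) (k : R) :
  0 < k ->
  (forall e : R, 0 < e -> \forall n \near \oo, u n <= k * v n + e) ->
  (limn_esup (fun n => (u n)%:E) <= k%:E * limn_esup (fun n => (v n)%:E))%E.
Proof.
move=> k0 uv; rewrite -lee_pdivrMl //.
apply: le_ereal_inf_tmp => _ [V Vn <-]; rewrite lee_pdivrMl //.
apply/lee_addgt0Pr => e e0.
apply: ge_ereal_inf; exists (ereal_sup [set (u n)%:E |
  n in V `&` [set n | u n <= k * v n + e]]).
  eexists; last by reflexivity.
  by apply: filterI => //; exact: uv.
apply: ge_ereal_sup => _ [n [Vn' /= un] <-].
apply: (@le_trans _ _ (k%:E * (v n)%:E + e%:E)%E).
  by rewrite -EFinM -EFinD lee_fin.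
rewrite leeD2r // lee_pmul2l // ?lte_fin //.
by apply: ereal_sup_ubound; exists n.
Qed.

Lemma limn_esup_scale (R : realType) (u v : nat -> R) (k : R) : 0 < k ->
  (forall e : R, 0 < e -> \forall n \near \oo, `|u n - k * v n| <= e) ->
  limn_esup (fun n => (u n)%:E) = (k%:E * limn_esup (fun n => (v n)%:E))%E.
Proof.
move=> k0 uv; apply/eqP; rewrite eq_le; apply/andP; split.
  apply: limn_esup_le_scale => // e /uv; apply: filterS => n.
  by rewrite ler_norml; lra.
rewrite -lee_pdivlMl //; apply: limn_esup_le_scale; first by rewrite invr_gt0.
move=> e e0; have /uv : 0 < k * e by rewrite mulr_gt0.
apply: filterS => n; rewrite ler_norml => /andP[H _].
rewrite -(ler_pM2l k0) mulrDr mulrA divff ?gt_eqF //; lra.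
Qed.

(** The bound ln y <= y - 1 at y = e (n + 1) already shows that ln (n + 1) = o(n). *)
Lemma ln_succ_little (R : realType) (e : R) : 0 < e ->
  exists K : R, forall n : nat, ln (n.+1%:R : R) <= e * n%:R + K.
Proof.
move=> e0; exists (e - 1 - ln e) => n.
have n0 : 0 < n.+1%:R :> R by rewrite ltr0n.
have en : 0 < e * n.+1%:R by rewrite mulr_gt0.
have := @le_ln1Dx R (e * n.+1%:R - 1); rewrite addrCA subrr addr0.
rewrite lnM ?posrE // => /(_ _).
by rewrite -[n.+1]addn1 natrD => H; have := H ltac:(lra); lra.
Qed.

(** Comparing f with g ^+ 2 up to a polynomial factor is enough, because ln of such
a factor is o(n). The polynomial slack absorbs the parabolic paths, where the
values of the form grow quadratically while the spectral radius stays bounded;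
with g = 1 the lemma says that subexponential growth has exponent zero. *)
Lemma growth_exponent_eq (R : realType) (f g : nat -> R) (c C : R) : 0 < c ->
  (\forall n \near \oo, [/\ 0 < g n, c * g n ^+ 2 <= f n
                          & f n <= C * n.+1%:R ^+ 2 * g n ^+ 2]) ->
  limn_esup (fun n => (ln (f n) / n%:R)%:E) =
  (2%:E * limn_esup (fun n => (ln (g n) / n%:R)%:E))%E.
Proof.
move=> c0 fg; apply: limn_esup_scale => // e e0.
have e4 : 0 < e / 4 by lra.
have [K Kn] := ln_succ_little e4.
have [M Mp] : exists M : R, forall x : R, 0 < x <= C -> ln x <= M.
  exists `|ln C| => x /andP[x0 xC]; apply: le_trans (ler_norm _).
  by rewrite ler_ln ?posrE //; exact: lt_le_trans xC.
pose B := (`|ln c| + `|M| + 2 * `|K|) * 2 / e.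
have B0 : 0 <= B by rewrite divr_ge0 ?mulr_ge0 ?addr_ge0 ?mulr_ge0 ?normr_ge0 // ltW.
have /= HN := archi_boundP B0; set N := Num.bound B in HN.
near=> n.
have [g0 lo hi] : [/\ 0 < g n, c * g n ^+ 2 <= f n
                          & f n <= C * n.+1%:R ^+ 2 * g n ^+ 2] by near: n.
have nN : (N.+1 <= n)%N by near: n; exact: nbhs_infty_ge.
have nN' : N%:R < n%:R :> R by rewrite ltr_nat.
have n0 : 0 < n%:R :> R by rewrite ltr0n; lia.
have g2 : 0 < g n ^+ 2 by rewrite exprn_gt0.
have m0 : 0 < n.+1%:R :> R by rewrite ltr0n.
have m2 : 0 < n.+1%:R ^+ 2 :> R by rewrite exprn_gt0.
have f0 : 0 < f n by apply: lt_le_trans lo; rewrite mulr_gt0.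
have C0 : 0 < C.
  have : 0 < C * n.+1%:R ^+ 2 * g n ^+ 2 by exact: lt_le_trans hi.
  by rewrite !pmulr_lgt0.
have Llo : ln c + 2 * ln (g n) <= ln (f n).
  have -> : 2 * ln (g n) = ln (g n ^+ 2) by rewrite lnXn // mulr_natl.
  by rewrite -lnM ?posrE // ler_ln ?posrE // mulr_gt0.
have Lhi : ln (f n) <= ln C + 2 * ln n.+1%:R + 2 * ln (g n).
  have -> : 2 * ln (g n) = ln (g n ^+ 2) by rewrite lnXn // mulr_natl.
  have -> : 2 * ln n.+1%:R = ln (n.+1%:R ^+ 2) :> R by rewrite lnXn // mulr_natl.
  rewrite -!lnM ?posrE // ?mulr_gt0 // ler_ln ?posrE //.
  by rewrite !mulr_gt0.
have CM : ln C <= M by apply: Mp; rewrite C0 lexx.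
have -> : ln (f n) / n%:R - 2 * (ln (g n) / n%:R)
          = (ln (f n) - 2 * ln (g n)) / n%:R by field; lra.
rewrite normrM normfV (gtr0_norm n0) ler_pdivrMr //.
(* For n > B the constants are at most e n / 2; the other half of e n absorbs
   2 ln (n + 1), up to the constant 2 K. *)
have Bn : `|ln c| + `|M| + 2 * `|K| <= e / 2 * n%:R.
  by move: HN; rewrite /B ltr_pdivrMr // => HN; nra.
have := Kn n; have := ler_norm M; have := ler_norm K.
have := ler_norm (- ln c); rewrite normrN.
have := normr_ge0 M; have := normr_ge0 K; have := normr_ge0 (ln c).
move=> H1 H2 H3 H4 H5 H6 H7.
by rewrite ler_norml; apply/andP; split; lra.
Unshelve. all: by end_near.
Qed.

(** * Spectral radius and trace *)

Lemma eigenvalue2 (F : fieldType) (A : 'M[F]_2) (z : F) :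
  eigenvalue A z = (z ^+ 2 - \tr A * z + \det A == 0).
Proof.
have sz := size_char_poly A.
have lc : (char_poly A)`_2 = 1.
  by have /monicP := char_poly_monic A; rewrite lead_coefE sz.
rewrite eigenvalue_root_char /root horner_coef sz !big_ord_recr big_ord0 /=.
have /= -> := char_poly_trace A isT; rewrite char_poly_det lc expr0 expr1.
rewrite !sqrrN expr1n.
by congr (_ == 0); ring.
Qed.

(** For a matrix of determinant 1 and trace t, the eigenvalues are the roots of
z^2 - t z + 1. The real root (t + sqrt (t^2 - 4)) / 2 gives the lower bound, and
|z|^2 <= t |z| + 1 the upper one; such crude bounds suffice, as only ln / n
matters. *)
Lemma spectral_radius_trace (R : realType) (A : 'M[int]_2) :
  \det A = 1 -> 2 <= \tr A ->
  (\tr A)%:~R / 2 <= spectral_radius R A <= (\tr A)%:~R + 1.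
Proof.
move=> detA trA; set t : R := (\tr A)%:~R.
have t2 : 2 <= t by rewrite /t -[2]/(2%:~R) ler_int.
pose S := [set r : R | exists2 z : R[i],
         eigenvalue (map_mx intr A) z & r = complex.Re `|z|].
have evE z : eigenvalue (map_mx intr A : 'M[R[i]]_2) z =
   (z ^+ 2 - (t%:C)%C * z + 1 == 0).
  rewrite eigenvalue2 det_map_mx detA.
  by rewrite trace_map_mx rmorph1 rmorph_int.
have ub : ubound S (t + 1).
  move=> _ [z + ->]; rewrite evE => /eqP ez.
  have zz : `|z| ^+ 2 <= (t%:C)%C * `|z| + 1.
    rewrite -normrX; have -> : z ^+ 2 = (t%:C)%C * z - 1.
      by apply/eqP; rewrite -subr_eq0 -{}ez; apply/eqP; ring.
    apply: (le_trans (ler_normB _ _)).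
    rewrite normrM normr1 ger0_norm // ler0c; lra.
  have nE : `|z| = ((complex.Re `|z|)%:C)%C by case: (z).
  have r0 : 0 <= complex.Re `|z| by rewrite -ler0c -nE.
  move: zz; rewrite nE -!rmorphXn -rmorphM -[1](rmorph1 (real_complex R)).
  rewrite -rmorphD lecR /=; set r := complex.Re _ in r0 *; nra.
have [z Sz tz] : exists2 r : R, S r & t / 2 <= r.
  have D0 : 0 <= t ^+ 2 - 4 by nra.
  pose s := Num.sqrt (t ^+ 2 - 4).
  have s2 : s ^+ 2 = t ^+ 2 - 4 by rewrite sqr_sqrtr.
  have s0 : 0 <= s by exact: sqrtr_ge0.
  exists ((t + s) / 2); last by lra.
  exists (((t + s) / 2)%:C)%C.
    rewrite evE; have -> : forall w : R, ((w%:C)%C ^+ 2 - (t%:C)%C * (w%:C)%C + 1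
              = ((w ^+ 2 - t * w + 1)%:C)%C).
      by move=> w; rewrite rmorphD rmorphB rmorphXn rmorphM rmorph1.
    have -> : ((t + s) / 2) ^+ 2 - t * ((t + s) / 2) + 1
              = (s ^+ 2 - (t ^+ 2 - 4)) / 4 by field.
    by rewrite s2 subrr mul0r eqxx.
  by rewrite ger0_norm ?ler0c //=; lra.
apply/andP; split.
  by apply: (le_trans tz); apply: ub_le_sup => //; exists (t + 1).
by apply: ge_sup => //; exists z.
Qed.

(** * Path matrices *)

(** The matrix of the unreflected path, also used for negative points: see
[pathmx_entry]. *)
Definition walk (w : nat -> turn) (n : nat) : 'M[int]_2 :=
  \prod_(i < n) turnmx (w i).

Lemma sum_ord2 (V : nmodType) (F : 'I_2 -> V) : \sum_i F i = F 0 + F 1.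
Proof. by rewrite big_ord_recl big_ord1; congr (_ + F _); apply: val_inj. Qed.

Lemma ord2P (P : 'I_2 -> Prop) : P 0 -> P 1 -> forall i, P i.
Proof.
move=> P0 P1 [[|[|//]] ?]; [move: P0|move: P1];
  by congr (P _); apply: val_inj.
Qed.

Lemma walkS w n : walk w n.+1 = walk w n *m turnmx (w n).
Proof. by rewrite /walk big_ord_recr. Qed.

Lemma walk_recl w n : walk w n.+1 = turnmx (w 0%N) *m walk (w \o succn) n.
Proof. by rewrite /walk big_ord_recl. Qed.

Lemma eq_walk w1 w2 n : (forall i, (i < n)%N -> w1 i = w2 i) ->
  walk w1 n = walk w2 n.
Proof. by move=> e; apply: eq_bigr => i _; rewrite e. Qed.

Lemma walk0E w i j : walk w 0 i j = (i == j)%:R.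
Proof. by rewrite /walk big_ord0 mxE. Qed.

Lemma walkS_col0 w n i : walk w n.+1 i 0 =
  if w n is Left then walk w n i 0 else walk w n i 0 + walk w n i 1.
Proof.
by rewrite walkS mxE sum_ord2; case: (w n); rewrite !mxE /= ?mulr1 ?mulr0 ?addr0.
Qed.

Lemma walkS_col1 w n i : walk w n.+1 i 1 =
  if w n is Left then walk w n i 0 + walk w n i 1 else walk w n i 1.
Proof.
by rewrite walkS mxE sum_ord2; case: (w n); rewrite !mxE /= ?mulr1 ?mulr0 ?add0r.
Qed.

Lemma walk_ge0 w n i j : 0 <= walk w n i j.
Proof.
elim: n j => [|n IH]; first by move=> j; rewrite walk0E ler0n.
by apply: ord2P; rewrite (walkS_col0, walkS_col1); case: (w n);
  rewrite ?addr_ge0 ?IH.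
Qed.

Lemma walk_det w n :
  walk w n 0 0 * walk w n 1 1 - walk w n 0 1 * walk w n 1 0 = 1.
Proof.
elim: n => [|n IH]; first by rewrite !walk0E.
by rewrite !walkS_col0 !walkS_col1; case: (w n); rewrite -[RHS]IH; ring.
Qed.

Lemma walk_diag_gt0 w n : 0 < walk w n 0 0 /\ 0 < walk w n 1 1.
Proof.
have p0 := walk_ge0 w n 0 0; have s0 := walk_ge0 w n 1 1.
have q0 := walk_ge0 w n 0 1; have r0 := walk_ge0 w n 1 0.
by have := walk_det w n; nia.
Qed.

(** * Reflected paths *)

Lemma turnmx_inv t i j :
  ((turnmx t)^-1 : 'M[int]_2) i j = (-1) ^+ (i != j) * turnmx t i j.
Proof.
pose U : 'M[int]_2 := \matrix_(i, j) ((-1) ^+ (i != j) * turnmx t i j).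
have TU : turnmx t * U = 1.
  apply/matrixP; apply: ord2P; apply: ord2P;
    by rewrite !mxE sum_ord2 !mxE; case: t @U => U; rewrite /turnmx !mxE.
have UT : U * turnmx t = 1 by exact: mulmx1C.
have Tu : turnmx t \is a GRing.unit by apply/unitrP; exists U.
have -> : (turnmx t)^-1 = U by rewrite -[LHS]mulr1 -TU mulrA mulVr ?mul1r.
by rewrite mxE.
Qed.

(** Conjugation by diag(1, -1) exchanges each letter with its inverse, so that the
reflected matrix is the unreflected one up to the signs off the diagonal. *)
Lemma pathmx_entry (R : realType) (xi : RP1 R) w n i j :
  pathmx xi w n i j = (-1) ^+ (neg_point xi && (i != j)) * walk w n i j.
Proof.
rewrite /pathmx /walk; case: (neg_point xi) => /=; last by rewrite mul1r.
elim: n i j => [|n IH] i j.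
  by rewrite !big_ord0 !mxE; case: eqP; rewrite ?mulr1 ?mulr0.
rewrite !big_ord_recr /= !mxE !sum_ord2 !IH !turnmx_inv.
by elim/ord2P: i; elim/ord2P: j; rewrite /=; ring.
Qed.

Lemma det2 (T : comNzRingType) (A : 'M[T]_2) :
  \det A = A 0 0 * A 1 1 - A 0 1 * A 1 0.
Proof.
rewrite (expand_det_row _ 0) sum_ord2 /cofactor !det_mx11 !mxE /=.
rewrite expr0 mul1r expr1 mulN1r mulrN.
by congr (A _ _ * A _ _ - A _ _ * A _ _); apply: val_inj.
Qed.

Lemma det_pathmx (R : realType) (xi : RP1 R) w n : \det (pathmx xi w n) = 1.
Proof.
rewrite det2 !pathmx_entry -[RHS](walk_det w n).
by case: (neg_point xi) => /=; ring.
Qed.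

Lemma tr_pathmx (R : realType) (xi : RP1 R) w n :
  \tr (pathmx xi w n) = walk w n 0 0 + walk w n 1 1.
Proof. by rewrite /mxtrace sum_ord2 !pathmx_entry /= andbF !mul1r. Qed.

(** [topo_norm] as a function of the unreflected matrix. *)
Definition superbase_norm (a h b : int) (M : 'M[int]_2) : int :=
  Num.max `|qform a h b (M 0 0) (M 1 0)|
    (Num.max `|qform a h b (M 0 1) (M 1 1)|
             `|qform a h b (M 0 0 + M 0 1) (M 1 0 + M 1 1)|).

Lemma qformN (T : comNzRingType) (a h b : int) (x y : T) :
  qform a (- h) b x y = qform a h b (- x) y.
Proof. by rewrite /qform rmorphN /=; ring. Qed.

Lemma qformNN (T : comNzRingType) (a h b : int) (x y : T) :
  qform a h b (- x) (- y) = qform a h b x y.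
Proof. by rewrite /qform; ring. Qed.

(** Reflecting the path amounts to replacing the form Q(x, y) by Q(x, -y); this
reduces negative points to positive ones. *)
Lemma topo_norm_walk (R : realType) (a h b : int) (xi : RP1 R) w n :
  topo_norm a h b xi w n =
  superbase_norm a (if neg_point xi then - h else h) b (walk w n).
Proof.
rewrite /topo_norm /superbase_norm /qform_col.
case: ifP => neg; rewrite !mxE !pathmx_entry neg /= ?expr0 ?expr1 ?mul1r //.
rewrite !qformN !mulN1r -(qformNN a h b (- walk w n 0 0)).
rewrite -(qformNN a h b (- (walk w n 0 0 + _))).
by rewrite !opprK !opprD.
Qed.

(** * Continued fractions and nested cones *)

(** M^-1 (X, Y) >= 0 for M of determinant 1: the direction (X, Y) lies in the cone
spanned by the columns of M. *)
Definition encloses (R : realType) (M : 'M[int]_2) (X Y : R) : Prop :=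
  (M 0 1)%:~R * Y <= (M 1 1)%:~R * X /\ (M 1 0)%:~R * X <= (M 0 0)%:~R * Y.

Lemma encloses_scale (R : realType) M (k X Y : R) :
  0 <= k -> encloses M X Y -> encloses M (k * X) (k * Y).
Proof.
by move=> k0 [H1 H2]; split; rewrite mulrCA [X in _ <= X]mulrCA ler_wpM2l.
Qed.

Lemma encloses_turn (R : realType) t M (X Y : R) : encloses M X Y ->
  encloses (turnmx t *m M) (if t is Left then X + Y else X)
                           (if t is Left then Y else X + Y).
Proof.
rewrite /encloses !mxE !sum_ord2; case: t;
  rewrite !mxE /= ?mul1r ?mul0r ?add0r ?addr0 ?rmorphD /=;
  by move=> [H1 H2]; split; rewrite ?mulrDl ?mulrDr; lra.
Qed.

(** The end of the path [cfword t s] in homogeneous coordinates. The word without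
blocks is t^oo, which ends at infinity for Left, whereas [cfval] is 0 there. *)
Definition cfpoint (R : realType) (t : turn) (s : seq nat) : R * R :=
  let v := if s is [::] then (1, 0) else (cfval R s, 1) in
  if t is Left then v else (v.2, v.1).

Lemma cfval_ge0 (R : realType) s : 0 <= cfval R s.
Proof. by elim: s => //= c s IH; rewrite addr_ge0 // invr_ge0. Qed.

(** Reading the first letter T of a word turns the end (X, Y) of the remaining path
into T (X, Y), and cones are preserved by T; hence every cone along the path
contains its end. *)
Lemma encloses_cfword (R : realType) n t s : all (leq 1) (behead s) ->
  encloses (walk (cfword t s) n) (cfpoint R t s).1 (cfpoint R t s).2.
Proof.
elim: n t s => [|n IH] t s s1.
  have -> : walk (cfword t s) 0 = 1 by rewrite /walk big_ord0.
  rewrite /encloses !mxE /= !rmorph1 !rmorph0 /cfpoint.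
  by case: t; case: s s1 => [|c s] _ /=;
    rewrite ?mul0r ?mul1r ?addr_ge0 ?invr_ge0 ?cfval_ge0.
(* A first block of length 0 merely exchanges the letters, and in that case the
   next block is nonempty: it suffices to treat a nonempty first block. *)
have base t' s' : s' = [::] \/ (0 < head 0%N s')%N -> all (leq 1) (behead s') ->
    encloses (walk (cfword t' s') n.+1) (cfpoint R t' s').1 (cfpoint R t' s').2.
  case: s' => [|[|c] s'] [] //= _ s1'; rewrite walk_recl.
    have := encloses_turn t' (@IH t' [::] isT).
    by rewrite /cfpoint; case: t' => /=; rewrite ?addr0 ?add0r.
  have -> : cfword t' (c.+1 :: s') \o succn = cfword t' (c :: s').
    by apply/funext => i /=; rewrite ltnS subSS.
  have := encloses_turn t' (IH t' (c :: s') s1').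
  have e : c.+1%:R + (cfval R s')^-1 = c%:R + (cfval R s')^-1 + 1.
    by rewrite -[c.+1]addn1 natrD; ring.
  by rewrite /cfpoint; case: t' => /=; rewrite ?e ?[1 + (_ + _)]addrC.
case: s s1 => [|[|c] s] s1; [by apply: base => //; left| |by apply: base => //; right].
have -> : cfword t (0%N :: s) = cfword (flip t) s.
  by apply/funext => i /=; rewrite subn0.
have s1' : all (leq 1) (behead s) by move: s1; case: s => //= c s /andP[].
have sP : s = [::] \/ (0 < head 0%N s)%N.
  by case: s s1 {s1'} => [|c s] /=; [left|case/andP; right].
have := base (flip t) s sP s1'.
case: s s1 sP {s1'} => [|c s] _ sP.
  by rewrite /cfpoint; case: t; rewrite /= invr0 addr0.
set v := cfval R (c :: s).
(* The points (v, 1) and (1, v^-1) agree up to the positive factor v^-1. *)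
have v0 : 0 < v.
  rewrite ltr_wpDr ?invr_ge0 ?cfval_ge0 //.
  by case: sP => //=; rewrite ltr0n.
have vi : 0 <= v^-1 by rewrite invr_ge0 ltW.
move/(encloses_scale vi).
have vv : v^-1 * v = 1 by rewrite mulVf // gt_eqF.
by rewrite /cfpoint; case: t => /=; rewrite -/v mulr1 vv add0r.
Qed.

Lemma cfword_cat t s s' n : (n < sumn s)%N ->
  cfword t (s ++ s') n = cfword t s n.
Proof.
elim: s t n => [|c s IH] t n //= ns.
by case: ltnP => // cn; rewrite IH // ltn_subLR.
Qed.

Lemma sumn_mkseq (c : nat -> nat) n : (forall i, 0 < c i.+1)%N ->
  (n <= sumn (mkseq c n.+1))%N.
Proof.
move=> c0; elim: n => // n IH.
rewrite /mkseq -[n.+2]addn1 iotaD map_cat sumn_cat /= addn0.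
by move: IH (c0 n); rewrite /mkseq add0n /=; lia.
Qed.

Lemma behead_mkseq_gt0 (c : nat -> nat) n : (forall i, 0 < c i.+1)%N ->
  all (leq 1) (behead (mkseq c n)).
Proof.
move=> c0; case: n => // n; rewrite /mkseq /=.
by apply/allP => _ /seq.mapP[i + ->]; rewrite mem_iota; case: i.
Qed.

(** Infinite expansions are the limits of the finite case: the first n letters are
shared by the words of all sufficiently long convergents, each of which lies in
the closed cone of the n-th matrix. *)
Lemma path_encloses (R : realType) (x : R) w n :
  path_word (Some x : RP1 R) w -> encloses (walk w n) `|x| 1.
Proof.
case=> [[c0 [s [s1 <- ws]]]|[c [c0 cx wc]]].
  have -> : w = cfword Left (c0 :: s) by apply/funext.
  exact: encloses_cfword.
have H N : encloses (walk w n) (cfval R (mkseq c (n.+2 + N))) 1.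
  have -> : walk w n = walk (cfword Left (mkseq c (n.+2 + N))) n.
    apply: eq_walk => i ni; rewrite wc.
    have -> : (n.+2 + N = i.+2 + (n - i + N))%N by lia.
    rewrite [mkseq c (i.+2 + _)]/mkseq iotaD map_cat cfword_cat //.
    exact: sumn_mkseq.
  by exact: (encloses_cfword R n Left (behead_mkseq_gt0 _ c0)).
have cx' : cfval R (mkseq c (n.+2 + N)) @[N --> \oo] --> `|x|.
  under eq_fun do rewrite addnC.
  by move: cx; rewrite -(cvg_shiftn n.+2).
have lim k : k%:~R * cfval R (mkseq c (n.+2 + N)) @[N --> \oo] --> k%:~R * `|x|.
  by apply: cvgM => //; exact: cvg_cst.
split.
  by apply: (cvgr_to_ge (lim _)); apply: nearW => N; have [] := H N.
by apply: (cvgr_to_le (lim _)); apply: nearW => N; have [] := H N.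
Qed.

(** * Values of the form on a superbase *)

Lemma qform_intr (R : realType) (a h b x y : int) :
  (qform a h b x y)%:~R = qform a h b (x%:~R : R) y%:~R.
Proof. by rewrite /qform !rmorphD !rmorphM /= !intz; ring. Qed.

Lemma superbase_norm_lub (R : realType) (a h b : int) (M : 'M[int]_2) (m : R) :
  `|qform a h b (M 0 0)%:~R (M 1 0)%:~R| <= m ->
  `|qform a h b (M 0 1)%:~R (M 1 1)%:~R| <= m ->
  `|qform a h b ((M 0 0)%:~R + (M 0 1)%:~R) ((M 1 0)%:~R + (M 1 1)%:~R)| <= m ->
  (superbase_norm a h b M)%:~R <= m.
Proof.
rewrite -!rmorphD /= -!qform_intr -!intr_norm => Hu Hv Huv.
by rewrite /superbase_norm /Num.max; case: ifP => // _; case: ifP.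
Qed.

Lemma superbase_norm_ub (R : realType) (a h b : int) (M : 'M[int]_2) :
  `|qform a h b ((M 0 0)%:~R : R) (M 1 0)%:~R| <= (superbase_norm a h b M)%:~R /\
  `|qform a h b ((M 0 1)%:~R : R) (M 1 1)%:~R| <= (superbase_norm a h b M)%:~R.
Proof.
by rewrite -!qform_intr -!intr_norm !ler_int /superbase_norm !le_max !lexx orbT.
Qed.

Lemma anisotropic_ge1 (R : realType) (a h b x y : int) :
  ~ represents_zero a h b -> (x, y) != (0, 0) ->
  1 <= `|qform a h b (x%:~R : R) y%:~R|.
Proof.
move=> nz xy; rewrite -qform_intr -intr_norm -[1](mulr1z 1) ler_int.
by rewrite -gtz0_ge1 normr_gt0; apply/eqP => Q0; apply: nz; exists x, y.
Qed.

Lemma anisotropic_columns (R : realType) (a h b : int) w n :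
  ~ represents_zero a h b ->
  1 <= `|qform a h b ((walk w n 0 0)%:~R : R) (walk w n 1 0)%:~R| /\
  1 <= `|qform a h b ((walk w n 0 1)%:~R : R) (walk w n 1 1)%:~R|.
Proof.
move=> nz; have [p0 s0] := walk_diag_gt0 w n.
by split; apply: anisotropic_ge1 => //;
  rewrite xpair_eqE negb_and ?(gt_eqF p0) ?(gt_eqF s0) ?orbT.
Qed.

Lemma superbase_norm_ge1 (R : realType) (a h b : int) w n :
  ~ represents_zero a h b ->
  1 <= (superbase_norm a h b (walk w n))%:~R :> R.
Proof.
move=> /(anisotropic_columns R w n)[Qu _].
by apply: le_trans Qu _; have [] := superbase_norm_ub R a h b (walk w n).
Qed.

Lemma qform_le (R : realType) (a h b : int) (x y m : R) :
  `|x| <= m -> `|y| <= m ->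
  `|qform a h b x y| <= (`|a%:~R| + `|h%:~R| + `|b%:~R|) * m ^+ 2.
Proof.
move=> xm ym; rewrite /qform.
have m0 : 0 <= m by exact: le_trans xm.
apply: (le_trans (ler_normD _ _)); rewrite mulrDl.
apply: lerD; last by rewrite normrM normrX ler_wpM2l // lerXn2r ?nnegrE.
apply: (le_trans (ler_normD _ _)); rewrite mulrDl.
apply: lerD; first by rewrite normrM normrX ler_wpM2l // lerXn2r ?nnegrE.
by rewrite -mulrA !normrM ler_wpM2l // expr2 ler_pM.
Qed.

(** Column vectors along the path are (x y + e, y) with a small e; the form is then
close to its value Q(x, 1) y^2 on the ray through (x, 1). *)
Lemma qform_near_ray (R : realType) (a h b : int) (x y e : R) :
  `|e| <= 1 -> 1 <= y ->
  `|qform a h b (x * y + e) y - qform a h b x 1 * y ^+ 2|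
    <= (`|2 * a%:~R * x + h%:~R| + `|a%:~R|) * (y * `|e|).
Proof.
move=> e1 y1.
have -> : qform a h b (x * y + e) y - qform a h b x 1 * y ^+ 2 =
  (2 * a%:~R * x + h%:~R) * (y * e) + a%:~R * (e * e) by rewrite /qform; ring.
apply: (le_trans (ler_normD _ _)); rewrite [X in _ <= X]mulrDl !normrM.
have y0 : `|y| = y by rewrite ger0_norm //; lra.
rewrite y0 lerD // ler_wpM2l // ler_wpM2r //.
exact: le_trans y1.
Qed.

(** Both errors of slope are nonnegative since x lies in the cone, and the
identity, a form of the determinant being 1, makes them at most 1/s and 1/r. *)
Lemma slope_error (R : realType) (w : nat -> turn) (n : nat) (x : R) :
  encloses (walk w n) x 1 ->
  let p := (walk w n 0 0)%:~R in let q := (walk w n 0 1)%:~R in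
  let r := (walk w n 1 0)%:~R in let s := (walk w n 1 1)%:~R in
  [/\ 0 <= p - x * r, 0 <= x * s - q
    & s * (p - x * r) + r * (x * s - q) = 1].
Proof.
move=> [H1 H2] p q r s; rewrite -/p -/q -/r -/s in H1 H2.
have : p * s - q * r = 1.
  by rewrite /p /q /r /s -!rmorphM -rmorphB /= walk_det.
by split; lra.
Qed.

(** A path that never turns right consists of the matrices L^n, whose cones
leave every finite x; after the first right turn r and s are both positive, and
each step then increases r + s. *)
Lemma walk_bottom_grows (R : realType) (w : nat -> turn) (x : R) :
  (forall n, encloses (walk w n) x 1) ->
  exists N : nat, forall n, (N <= n)%N ->
    1 <= walk w n 1 0 /\ n%:Z <= walk w n 1 0 + walk w n 1 1 + N%:Z.
Proof.
move=> encl.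
have [N rN] : exists N, 1 <= walk w N 1 0.
  apply/not_existsP => r0.
  have {}r0 n : walk w n 1 0 = 0.
    by have := walk_ge0 w n 1 0; have := r0 n; lia.
  have ps n : walk w n 0 0 = 1 /\ walk w n 1 1 = 1.
    have := walk_det w n; have := walk_diag_gt0 w n.
    by rewrite r0 mulr0 subr0; nia.
  have qn n : walk w n 0 1 = n%:Z.
    elim: n => [|n IH]; first by rewrite walk0E.
    have [pn sn] := ps n; have := r0 n.+1.
    by rewrite walkS_col1 walkS_col0 IH pn sn r0; case: (w n); lia.
  have x0 : 0 <= x by have [+ _] := encl 0%N; rewrite !walk0E mulr1 mul1r.
  have := archi_boundP x0; set n := Num.bound x.
  have [+ _] := encl n; rewrite qn (ps n).2 mulr1 mul1r.
  by rewrite -pmulrn; lra.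
exists N => n Nn; rewrite -(subnK Nn) addnC; elim: (n - N)%N => [|k [IH1 IH2]].
  by rewrite addn0; split=> //; have := walk_ge0 w N 1 0; have := walk_ge0 w N 1 1; lia.
rewrite addnS walkS_col0 walkS_col1; have [_ s0] := walk_diag_gt0 w (N + k).
by case: (w _); lia.
Qed.

Lemma superbase_norm_walk_le (R : realType) (a h b : int) w n (m : R) :
  (walk w n 0 0)%:~R + (walk w n 0 1)%:~R <= m ->
  (walk w n 1 0)%:~R + (walk w n 1 1)%:~R <= m ->
  (superbase_norm a h b (walk w n))%:~R
    <= (`|a%:~R| + `|h%:~R| + `|b%:~R|) * m ^+ 2.
Proof.
have w0 i j : 0 <= (walk w n i j)%:~R :> R by rewrite ler0z walk_ge0.
move=> pq rs; have := w0 0 0; have := w0 0 1; have := w0 1 0; have := w0 1 1.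
move=> s0 r0 q0 p0.
by apply: superbase_norm_lub; apply: qform_le; rewrite ger0_norm; lra.
Qed.

(** The paths to 0 and infinity: one off-diagonal entry vanishes for ever, so the
trace is 2, while the other entry grows at most linearly. *)
Lemma growth_degenerate (R : realType) (a h b : int) (w : nat -> turn) :
  ~ represents_zero a h b ->
  (forall n, walk w n 0 1 = 0) \/ (forall n, walk w n 1 0 = 0) ->
  exists c C : R, 0 < c /\ \forall n \near \oo,
    c * (walk w n 0 0 + walk w n 1 1)%:~R ^+ 2
      <= (superbase_norm a h b (walk w n))%:~R
      <= C * n.+1%:R ^+ 2 * (walk w n 0 0 + walk w n 1 1)%:~R ^+ 2.
Proof.
move=> nz deg.
have ps n : walk w n 0 0 = 1 /\ walk w n 1 1 = 1.
  have := walk_det w n; have := walk_diag_gt0 w n.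
  by case: deg => ->; rewrite ?mulr0 ?mul0r subr0; nia.
have le_n n : walk w n 0 1 <= n%:Z /\ walk w n 1 0 <= n%:Z.
  elim: n => [|n IH]; first by rewrite !walk0E.
  have [pn sn] := ps n.
  by rewrite walkS_col0 walkS_col1 pn sn; case: (w n); lia.
exists (1 / 4), (`|a%:~R| + `|h%:~R| + `|b%:~R|); split; first by lra.
apply: nearW => n; have [-> ->] := ps n.
have -> : (1 + 1)%:~R ^+ 2 = 4 :> R by rewrite rmorphD /= !mulr1z; ring.
rewrite div1r mulVf ?pnatr_eq0 //.
rewrite superbase_norm_ge1 //=.
have n1 : 1 <= n.+1%:R :> R by rewrite ler1n.
have -> : (`|a%:~R| + `|h%:~R| + `|b%:~R|) * n.+1%:R ^+ 2 * 4
  = (`|a%:~R| + `|h%:~R| + `|b%:~R|) * (2 * n.+1%:R) ^+ 2 :> R by ring.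
have [pn sn] := ps n; have [qn rn] := le_n n.
rewrite -!(ler_int R) -pmulrn in qn rn.
have e : n.+1%:R = n%:R + 1 :> R by rewrite -[n.+1]addn1 natrD.
by apply: superbase_norm_walk_le; rewrite ?pn ?sn mulr1z; lra.
Qed.

(** Once y is large, the error term of [qform_near_ray] is at most half the main
term. *)
Lemma qform_near_ray_ge (R : realType) (a h b : int) (x y e : R) :
  `|e| <= 1 -> 1 <= y ->
  2 * (`|2 * a%:~R * x + h%:~R| + `|a%:~R|) <= `|qform a h b x 1| * y ->
  `|qform a h b x 1| / 2 * y ^+ 2 <= `|qform a h b (x * y + e) y|.
Proof.
move=> e1 y1; have := @qform_near_ray R a h b x y e e1 y1.
have := ler_distD (qform a h b (x * y + e) y) (qform a h b x 1 * y ^+ 2) 0.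
rewrite !subr0 normrM normrX (@ger0_norm _ y); last by lra.
rewrite [`|_ * _ - _|]distrC.
have : y * `|e| <= y by rewrite ler_piMr //; lra.
have : 0 <= `|2 * a%:~R * x + h%:~R| + `|a%:~R| by rewrite addr_ge0.
move: (_ + `|a%:~R|) (y * `|e|) => K E.
move: `|qform _ _ _ x 1| `|qform _ _ _ _ y| `|_ - _| => k Q d.
move=> K0 Ey tri near Ky; have : K * E <= K * y by rewrite ler_wpM2l.
nra.
Qed.

(** As x > 0 lies between the slopes q/s and p/r, the diagonal entries bound the
other two. *)
Lemma cone_columns_le_trace (R : realType) (x p q r s : R) :
  0 < x -> 0 <= p -> 0 <= s -> 0 <= r -> q <= x * s -> x * r <= p ->
  p + q <= 2 * (1 + x + x^-1) * (p + s) /\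
  r + s <= 2 * (1 + x + x^-1) * (p + s).
Proof.
move=> x0 p0 s0 r0 qs rp.
have xi0 : 0 < x^-1 by rewrite invr_gt0.
have rx : r <= x^-1 * p by rewrite ler_pdivlMl.
have xp : 0 <= x * p by rewrite mulr_ge0 // ltW.
have xs : 0 <= x * s by rewrite mulr_ge0 // ltW.
have yp : 0 <= x^-1 * p by rewrite mulr_ge0 // ltW.
have ys : 0 <= x^-1 * s by rewrite mulr_ge0 // ltW.
by split; lra.
Qed.

(** If Q(x, 1) != 0, then |Q| on the column with the larger lower entry m is of order
m^2, and so is the squared trace. *)
Lemma growth_transversal (R : realType) (a h b : int) (w : nat -> turn) (x : R) :
  0 < x -> (forall n, encloses (walk w n) x 1) -> qform a h b x 1 != 0 ->
  exists c C : R, 0 < c /\ \forall n \near \oo,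
    c * (walk w n 0 0 + walk w n 1 1)%:~R ^+ 2
      <= (superbase_norm a h b (walk w n))%:~R
      <= C * n.+1%:R ^+ 2 * (walk w n 0 0 + walk w n 1 1)%:~R ^+ 2.
Proof.
move=> x0 encl; rewrite -normr_gt0; set k := `|qform a h b x 1| => k0.
have [N gN] := walk_bottom_grows encl.
pose K := `|2 * a%:~R * x + h%:~R| + `|a%:~R|.
pose A : R := `|a%:~R| + `|h%:~R| + `|b%:~R|.
pose D := 2 * (1 + x + x^-1).
have xi0 : 0 < x^-1 by rewrite invr_gt0.
have K0 : 0 <= K by rewrite addr_ge0.
have A0 : 0 <= A by rewrite !addr_ge0.
exists (k / 2 / (x + 2) ^+ 2), (A * D ^+ 2); split.
  by rewrite !divr_gt0 // exprn_gt0 //; lra.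
have B0 : 0 <= 4 * K / k by rewrite divr_ge0 ?mulr_ge0 // ltW.
near=> n.
have Nn : (N + Num.bound (4 * K / k)%R <= n)%N by near: n; exact: nbhs_infty_ge.
have {gN}[r1 rs] := gN n (leq_trans (leq_addr _ _) Nn).
have [p1 s1] := walk_diag_gt0 w n.
have := slope_error (encl n) => /=; rewrite rmorphD /=.
have := superbase_norm_ub R a h b (walk w n).
have := @superbase_norm_walk_le R a h b w n.
set S := (superbase_norm _ _ _ _)%:~R.
have {}rs : 4 * K / k <= (walk w n 1 0)%:~R + (walk w n 1 1)%:~R.
  apply: (le_trans (ltW (archi_boundP B0))).
  by rewrite -rmorphD /= pmulrn ler_int; lia.
have q0 : 0 <= (walk w n 0 1)%:~R :> R by rewrite ler0z walk_ge0.
move: p1 r1 s1 rs q0; rewrite !gtz0_ge1 -!(ler_int R) !mulr1z.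
set p := (walk w n 0 0)%:~R; set q := (walk w n 0 1)%:~R.
set r := (walk w n 1 0)%:~R; set s := (walk w n 1 1)%:~R.
clearbody S p q r s.
move=> p1 r1 s1 rs q0 Sub [Su Sv] [e0 f0 ef].
rewrite ler_pdivrMr // in rs.
apply/andP; split; last first.
  apply: (@le_trans _ _ (A * (D * (p + s)) ^+ 2)).
    have [pq rs'] : p + q <= D * (p + s) /\ r + s <= D * (p + s).
      by apply: cone_columns_le_trace => //; lra.
    exact: Sub.
  rewrite exprMn mulrA ler_wpM2r ?sqr_ge0 // ler_peMr //.
    by rewrite mulr_ge0 // sqr_ge0.
  by rewrite expr_ge1 ?ler1n // ler0n.
have e1 : `|p - x * r| <= 1 by rewrite ger0_norm //; nra.
have f1 : `|q - x * s| <= 1 by rewrite distrC ger0_norm //; nra.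
have pr : p <= x * r + 1 by move: e1; rewrite ler_norml; lra.
have scale y : 1 <= y -> p + s <= (x + 2) * y ->
    k / 2 / (x + 2) ^+ 2 * (p + s) ^+ 2 <= k / 2 * y ^+ 2.
  move=> y1 ty; rewrite -[leLHS]mulrA; apply: ler_wpM2l; first by lra.
  rewrite ler_pdivrMl; last by rewrite exprn_gt0 //; lra.
  by rewrite -exprMn lerXn2r // nnegrE; nra.
have [sr|rs'] := leP s r.
  apply: (le_trans (scale r r1 _)); first by lra.
  apply: le_trans Su; rewrite -[X in qform _ _ _ X r](subrKC (x * r)).
  by apply: qform_near_ray_ge => //; rewrite -/K -/k; nra.
apply: (le_trans (scale s s1 _)); first by nra.
apply: le_trans Sv; rewrite -[X in qform _ _ _ X s](subrKC (x * s)).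
by apply: qform_near_ray_ge => //; rewrite -/K -/k; nra.
Unshelve. all: by end_near.
Qed.

(** * Paths to a root of the form *)

(** The left-hand side is the discriminant of Q in the basis (p, r), (q, s). *)
Lemma discriminant_base_change (T : comNzRingType) (a h b : int) (p q r s : T) :
  (qform a h b (p + q) (r + s) - qform a h b p r - qform a h b q s) ^+ 2
    - 4 * qform a h b p r * qform a h b q s
  = (h%:~R ^+ 2 - 4 * a%:~R * b%:~R) * (p * s - q * r) ^+ 2.
Proof. by rewrite /qform; ring. Qed.

(** At a root x of the form, write e and f for the two slope errors. The main term of
Q vanishes, leaving |Q(u)| <= K r e and |Q(v)| <= K s f. As s e <= 1 and r f <= 1,
the product of the two values is bounded; as both are at least 1, r and s are
comparable, which says that the partial quotients of x are bounded. *)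
Lemma isotropic_columns (R : realType) (a h b : int) (w : nat -> turn) (x : R)
    (n : nat) :
  let K := `|2 * a%:~R * x + h%:~R| + `|a%:~R| in
  ~ represents_zero a h b -> qform a h b x 1 = 0 ->
  encloses (walk w n) x 1 -> 1 <= walk w n 1 0 ->
  [/\ `|qform a h b (walk w n 0 0)%:~R (walk w n 1 0)%:~R|
        * `|qform a h b (walk w n 0 1)%:~R (walk w n 1 1)%:~R| <= K ^+ 2,
      (walk w n 1 1)%:~R <= K * (walk w n 1 0)%:~R
    & (walk w n 1 0)%:~R <= K * (walk w n 1 1)%:~R].
Proof.
move=> K nz Qx encl r1.
have [_ s1] := walk_diag_gt0 w n.
have := slope_error encl => /=.
have [] := anisotropic_columns R w n nz.
move: r1 s1; rewrite !gtz0_ge1 -!(ler_int R) !mulr1z.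
set p := (walk w n 0 0)%:~R; set q := (walk w n 0 1)%:~R.
set r := (walk w n 1 0)%:~R; set s := (walk w n 1 1)%:~R.
clearbody p q r s => r1 s1 Qu Qv [e0 f0 ef].
have K0 : 0 <= K by rewrite addr_ge0.
have re0 : 0 <= r * (p - x * r) by rewrite mulr_ge0 //; lra.
have sf0 : 0 <= s * (x * s - q) by rewrite mulr_ge0 //; lra.
have se0 : 0 <= s * (p - x * r) by rewrite mulr_ge0 //; lra.
have rf0 : 0 <= r * (x * s - q) by rewrite mulr_ge0 //; lra.
have ne1 : `|p - x * r| <= 1 by rewrite ger0_norm //; nra.
have nf1 : `|q - x * s| <= 1 by rewrite distrC ger0_norm //; nra.
have := qform_near_ray a h b x ne1 r1; rewrite Qx mul0r subr0 -/K.
have := qform_near_ray a h b x nf1 s1; rewrite Qx mul0r subr0 -/K.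
rewrite !subrKC [`|q - _|]distrC (ger0_norm e0) (ger0_norm f0) => Hv Hu.
move: Hu Hv Qu Qv.
set X := `|qform _ _ _ p _|; set Y := `|qform _ _ _ q _| => Hu Hv X1 Y1.
split.
- apply: (@le_trans _ _ (K * (r * (p - x * r)) * (K * (s * (x * s - q))))).
    by apply: ler_pM => //; lra.
  have -> : K * (r * (p - x * r)) * (K * (s * (x * s - q)))
    = K ^+ 2 * ((s * (p - x * r)) * (r * (x * s - q))) by ring.
  rewrite ler_piMr ?sqr_ge0 //.
  by rewrite mulr_ile1 //; lra.
- have : s * 1 <= s * (K * (r * (p - x * r))) by rewrite ler_wpM2l; lra.
  have -> : s * (K * (r * (p - x * r))) = K * r * (s * (p - x * r)) by ring.
  have : K * r * (s * (p - x * r)) <= K * r.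
    by rewrite ler_piMr ?mulr_ge0 //; lra.
  lra.
- have : r * 1 <= r * (K * (s * (x * s - q))) by rewrite ler_wpM2l; lra.
  have -> : r * (K * (s * (x * s - q))) = K * s * (r * (x * s - q)) by ring.
  have : K * s * (r * (x * s - q)) <= K * s.
    by rewrite ler_piMr ?mulr_ge0 //; lra.
  lra.
Qed.

(** Two nonzero integers of bounded product are bounded. The discriminant then bounds
the middle coefficient Q(u + v) - Q(u) - Q(v), hence the third value. *)
Lemma superbase_norm_isotropic (R : realType) (a h b : int) (w : nat -> turn)
    (x : R) :
  ~ represents_zero a h b -> qform a h b x 1 = 0 ->
  (forall n, encloses (walk w n) x 1) ->
  exists B : R, \forall n \near \oo,
    1 <= ((superbase_norm a h b (walk w n))%:~R : R) <= B.
Proof.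
move=> nz Qx encl; have [N gN] := walk_bottom_grows encl.
pose K := `|2 * a%:~R * x + h%:~R| + `|a%:~R|.
pose D : R := h%:~R ^+ 2 - 4 * a%:~R * b%:~R.
exists (1 + `|D| + 6 * K ^+ 2); near=> n.
have Nn : (N <= n)%N by near: n; exact: nbhs_infty_ge.
rewrite superbase_norm_ge1 //=.
have [r1 _] := gN n Nn.
have [+ _ _] := isotropic_columns nz Qx (encl n) r1; rewrite -/K.
have [] := anisotropic_columns R w n nz.
have := @discriminant_base_change R a h b (walk w n 0 0)%:~R (walk w n 0 1)%:~R
  (walk w n 1 0)%:~R (walk w n 1 1)%:~R.
rewrite -!rmorphM -rmorphB walk_det /= expr1n mulr1 -/D.
have := @superbase_norm_lub R a h b (walk w n) (1 + `|D| + 6 * K ^+ 2).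
set U := qform a h b _ (walk w n 1 0)%:~R.
set V := qform a h b _ (walk w n 1 1)%:~R.
set W := qform a h b _ (_ + _); clearbody U V W.
move=> lub disc U1 V1 UV.
have UK : `|U| <= K ^+ 2 by apply: le_trans UV; rewrite ler_peMr.
have VK : `|V| <= K ^+ 2 by apply: le_trans UV; rewrite ler_peMl.
have WK : `|W - U - V| <= 1 + `|D| + 4 * K ^+ 2.
  have : `|W - U - V| ^+ 2 <= `|D| + 4 * K ^+ 2.
    rewrite -normrX; have -> : (W - U - V) ^+ 2 = D + 4 * (U * V).
      by rewrite -disc; ring.
    apply: (le_trans (ler_normD _ _)); rewrite lerD // !normrM ger0_norm //.
    by rewrite ler_wpM2l.
  by move: (normr_ge0 (W - U - V)); set H := `|_ - V|; nra.
have D0 := normr_ge0 D; have K0 := sqr_ge0 K.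
apply: lub; [by lra|by lra|].
have -> : W = (W - U - V) + (U + V) by ring.
apply: (le_trans (ler_normD _ _)); have := ler_normD U V; lra.
Unshelve. all: by end_near.
Qed.

(** Each step adds r or s to r + s. By [isotropic_columns] both are at least a fixed
proportion d of r + s, so r + s grows by the factor 1 + d. *)
Lemma trace_isotropic (R : realType) (a h b : int) (w : nat -> turn) (x : R) :
  ~ represents_zero a h b -> 0 <= x -> qform a h b x 1 = 0 ->
  (forall n, encloses (walk w n) x 1) ->
  exists c d : R, [/\ 0 < c, 1 < d & \forall n \near \oo,
    c * d ^+ n <= (walk w n 0 0 + walk w n 1 1)%:~R].
Proof.
move=> nz x0 Qx encl; have [N gN] := walk_bottom_grows encl.
pose K := `|2 * a%:~R * x + h%:~R| + `|a%:~R|.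
have K0 : 0 <= K by rewrite addr_ge0.
pose d := (1 + K)^-1; have d0 : 0 < d by rewrite invr_gt0; lra.
have dK : d * (1 + K) = 1 by rewrite mulVf // gt_eqF //; lra.
have min_le n : (N <= n)%N ->
  d * ((walk w n 1 0)%:~R + (walk w n 1 1)%:~R) <= (walk w n 1 0)%:~R /\
  d * ((walk w n 1 0)%:~R + (walk w n 1 1)%:~R) <= (walk w n 1 1)%:~R.
  move=> /gN[r1 _].
  have [_ + +] := isotropic_columns nz Qx (encl n) r1; rewrite -/K => sr rs.
  by rewrite mulrC !ler_pdivrMr; lra.
have grow k : (1 + d) ^+ k
    <= (walk w (N + k) 1 0)%:~R + (walk w (N + k) 1 1)%:~R :> R.
  elim: k => [|k IH].
    rewrite addn0 expr0 -rmorphD -[1](mulr1z 1) ler_int /=.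
    by have [r1 _] := gN N (leqnn N); have := walk_ge0 w N 1 1; lia.
  rewrite exprS addnS walkS_col0 walkS_col1.
  have [Hr Hs] := min_le (N + k)%N (leq_addr _ _).
  have d1 : 0 <= 1 + d by lra.
  have := ler_wpM2l d1 IH; rewrite mulrDl mul1r.
  by case: (w _); rewrite rmorphD /=; lra.
exists (d / (1 + d) ^+ N), (1 + d); split.
- by rewrite divr_gt0 // exprn_gt0 //; lra.
- by lra.
near=> n; have Nn : (N <= n)%N by near: n; exact: nbhs_infty_ge.
have := grow (n - N)%N; rewrite subnKC // => gn.
have [_ Hs] := min_le n Nn.
have -> : d / (1 + d) ^+ N * (1 + d) ^+ n = d * (1 + d) ^+ (n - N).
  rewrite -{1}(subnKC Nn) exprD; field.
  by rewrite expf_neq0 // gt_eqF //; lra.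
have : d * (1 + d) ^+ (n - N) <= d * ((walk w n 1 0)%:~R + (walk w n 1 1)%:~R).
  by rewrite ler_wpM2l // ltW.
have p0 : 0 <= (walk w n 0 0)%:~R :> R by rewrite ler0z walk_ge0.
by rewrite rmorphD /=; lra.
Unshelve. all: by end_near.
Qed.

Lemma Lambda_Q_eq0 (R : realType) (a h b : int) path (xi : RP1 R) (B : R) :
  (\forall n \near \oo, 1 <= ((topo_norm a h b xi (path xi) n)%:~R : R) <= B) ->
  Lambda_Q a h b path xi = 0%E.
Proof.
move=> bd; rewrite /Lambda_Q (@growth_exponent_eq _ _ (fun=> 1) 1 B) //.
  rewrite (_ : (fun=> _) = cst 0%E); last first.
    by apply/funext => n; rewrite ln1 mul0r.
  by rewrite limn_esup_cst mule0.
apply: filterS bd => n /andP[B1 B2]; rewrite expr1n !mulr1 ltr01; split=> //.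
have B0 : 0 <= B by lra.
apply: (le_trans B2); rewrite ler_peMr //.
by rewrite expr_ge1 // ?ler0n // ler1n.
Qed.

Lemma Lambda_gt0 (R : realType) path (xi : RP1 R) (c d : R) :
  0 < c -> 1 < d ->
  (\forall n \near \oo,
     c * d ^+ n <= spectral_radius R (pathmx xi (path xi) n)) ->
  (0 < Lambda path xi)%E.
Proof.
move=> c0 d1 bd; apply: (@lt_le_trans _ _ (ln d)%:E).
  by rewrite lte_fin ln_gt0.
rewrite -[leLHS]limn_esup_cst -[leRHS]mul1e; apply: limn_esup_le_scale => // e e0.
have B0 : 0 <= `|ln c| / e by rewrite divr_ge0 // ltW.
near=> n.
have lo : c * d ^+ n <= spectral_radius R (pathmx xi (path xi) n) by near: n.
have : `|ln c| / e < n%:R.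
  apply: (lt_le_trans (archi_boundP B0)); rewrite ler_nat.
  by near: n; exact: nbhs_infty_ge.
rewrite ltr_pdivrMr // => nB.
have n0 : 0 < n%:R :> R by rewrite ltr0n; near: n; exact: nbhs_infty_ge.
have dn : 0 < d ^+ n by rewrite exprn_gt0 //; lra.
have : ln (c * d ^+ n) <= ln (spectral_radius R (pathmx xi (path xi) n)).
  by rewrite ler_ln ?posrE //; [exact: mulr_gt0|apply: lt_le_trans lo; exact: mulr_gt0].
rewrite lnM ?posrE // lnXn; last by lra.
rewrite -[ln d *+ n]mulr_natl mul1r -lerBlDr ler_pdivlMr // => H.
have := ler_norm (- ln c); rewrite normrN; lra.
Unshelve. all: by end_near.
Qed.

(** * Exponents at a point of the projective line *)

Lemma spectral_radius_pathmx (R : realType) (xi : RP1 R) w n :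
  let t : R := (walk w n 0 0 + walk w n 1 1)%:~R in
  2 <= t /\ t / 2 <= spectral_radius R (pathmx xi w n) <= t + 1.
Proof.
move=> t; have tr2 : 2 <= walk w n 0 0 + walk w n 1 1.
  by have [] := walk_diag_gt0 w n; lia.
have := @spectral_radius_trace R _ (det_pathmx xi w n).
rewrite tr_pathmx => /(_ tr2); split => //.
by rewrite /t -[2]/(2%:~R) ler_int.
Qed.

Lemma lyapunov_eq (R : realType) (a h b : int) path (xi : RP1 R) (c C : R) :
  0 < c ->
  (\forall n \near \oo,
    let t : R := (walk (path xi) n 0 0 + walk (path xi) n 1 1)%:~R in
    c * t ^+ 2 <= (topo_norm a h b xi (path xi) n)%:~R
      <= C * n.+1%:R ^+ 2 * t ^+ 2) ->
  Lambda_Q a h b path xi = (2%:E * Lambda path xi)%E.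
Proof.
move=> c0 bd; apply: (@growth_exponent_eq _ _ _ (c / 4) (C * 4)); first by lra.
apply: filterS bd => n /=.
have [] := spectral_radius_pathmx xi (path xi) n.
move: (spectral_radius _ _) (_ + _)%:~R (topo_norm _ _ _ _ _ _)%:~R.
move=> rho t S t2 /andP[lo hi] /andP[Slo Shi].
have tt : 0 < t ^+ 2 by rewrite exprn_gt0 //; lra.
have n2 : 0 < n.+1%:R ^+ 2 :> R by rewrite exprn_gt0 // ltr0n.
have C0 : 0 < C.
  have : 0 < C * n.+1%:R ^+ 2 * t ^+ 2.
    by apply: lt_le_trans (le_trans Slo Shi); exact: mulr_gt0.
  by rewrite (pmulr_lgt0 _ tt) (pmulr_lgt0 _ n2).
split; first by lra.
  apply: le_trans Slo; rewrite -mulrA ler_wpM2l ?(ltW c0) // ler_pdivrMl //.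
  have -> : 4 * t ^+ 2 = (2 * t) ^+ 2 by ring.
  by rewrite lerXn2r // ?nnegrE; lra.
apply: (le_trans Shi).
have -> : C * 4 * n.+1%:R ^+ 2 * rho ^+ 2 = C * n.+1%:R ^+ 2 * (2 * rho) ^+ 2.
  by ring.
apply: ler_wpM2l; first by rewrite mulr_ge0 // ltW.
by rewrite lerXn2r // ?nnegrE; lra.
Qed.

Lemma represents_zeroN (a h b : int) :
  represents_zero a (- h) b -> represents_zero a h b.
Proof.
move=> [x [y [xy Q0]]]; exists (- x), y; rewrite -qformN; split => //.
by apply: contra_neq xy => -[/eqP]; rewrite oppr_eq0 => /eqP -> ->.
Qed.

Lemma qform_abs (R : realType) (a h b : int) (x : R) :
  qform a (if x < 0 then - h else h) b `|x| 1 = qform a h b x 1.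
Proof.
case: ltP => x0; first by rewrite ltr0_norm // qformN opprK.
by rewrite ger0_norm.
Qed.

(** The points 0 and infinity are treated apart: there the trace stays bounded while
the matrix grows. *)
Lemma nonroot_exponent (R : realType) (a h b : int) path (xi : RP1 R) :
  path_word xi (path xi) -> ~ represents_zero a h b ->
  (forall x, xi = Some x -> qform a h b x 1 != 0) ->
  Lambda_Q a h b path xi = (2%:E * Lambda path xi)%E.
Proof.
move=> wP nz Qxi; pose h' := if neg_point xi then - h else h.
have nz' : ~ represents_zero a h' b.
  by rewrite /h'; case: ifP => // _ /represents_zeroN.
suff [c [C [c0 bd]]] : exists c C : R, 0 < c /\ \forall n \near \oo,
    c * (walk (path xi) n 0 0 + walk (path xi) n 1 1)%:~R ^+ 2
      <= (superbase_norm a h' b (walk (path xi) n))%:~R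
      <= C * n.+1%:R ^+ 2
           * (walk (path xi) n 0 0 + walk (path xi) n 1 1)%:~R ^+ 2.
  by apply: (lyapunov_eq c0 (C := C)); apply: filterS bd => n; rewrite topo_norm_walk.
case: xi wP Qxi @h' nz' => [x|] wP Qxi h' nz'; last first.
  apply: growth_degenerate => //; right; elim=> [|n IH]; first by rewrite walk0E.
  by rewrite walkS_col0 wP.
have encl n := path_encloses n wP.
have [x0|x0] := eqVneq x 0.
  apply: growth_degenerate => //; left => n.
  have [+ _] := encl n; rewrite x0 normr0 mulr0 mulr1.
  by have := walk_ge0 (path (Some x)) n 0 1; rewrite x0 lerz0; lia.
apply: growth_transversal encl _; first by rewrite normr_gt0.
by rewrite qform_abs; exact: Qxi.
Qed.

Lemma root_exponents (R : realType) (a h b : int) path (x : R) :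
  path_word (Some x : RP1 R) (path (Some x)) -> ~ represents_zero a h b ->
  qform a h b x 1 = 0 ->
  Lambda_Q a h b path (Some x : RP1 R) = 0%E /\
  (0 < Lambda path (Some x : RP1 R))%E.
Proof.
move=> wP nz Qx; pose h' := if x < 0 then - h else h.
have nz' : ~ represents_zero a h' b.
  by rewrite /h'; case: ifP => // _ /represents_zeroN.
have encl n := path_encloses n wP.
have Qx' : qform a h' b `|x| 1 = 0 by rewrite qform_abs.
split.
  have [B bd] := superbase_norm_isotropic nz' Qx' encl.
  apply: (Lambda_Q_eq0 (B := B)); apply: filterS bd => n.
  by rewrite topo_norm_walk.
have [c [d [c0 d1 bd]]] := trace_isotropic nz' (normr_ge0 x) Qx' encl.
apply: (@Lambda_gt0 _ _ _ (c / 2) d) => //; first by lra.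
apply: filterS bd => n bd.
have [_ /andP[lo _]] := spectral_radius_pathmx (Some x : RP1 R) (path (Some x)) n.
by apply: le_trans lo; lra.
Qed.

Lemma indefinite_roots (R : realType) (a h b : int) :
  indefinite R a h b -> ~ represents_zero a h b ->
  exists alphap alpham : R, alphap <> alpham /\
    forall x : R, qform a h b x 1 = 0 <-> x = alphap \/ x = alpham.
Proof.
move=> [[x1 [y1 Q1]] [x2 [y2 Q2]]] nz.
have a0 : a%:~R != 0 :> R.
  rewrite intr_eq0; apply/eqP => a0; apply: nz; exists 1, 0; split => //.
  by rewrite a0 /qform; ring.
pose D : R := h%:~R ^+ 2 - 4 * a%:~R * b%:~R.
(* Completing the square: if D <= 0, the form is semidefinite. *)
have sq x y : 4 * a%:~R * qform a h b x y
  = (2 * a%:~R * x + h%:~R * y) ^+ 2 - D * y ^+ 2 :> R.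
  by rewrite /qform /D; ring.
have D0 : 0 < D.
  rewrite ltNge; apply/negP => D0.
  have pos x y : 0 <= a%:~R * qform a h b x y :> R.
    have := sq x y; have := sqr_ge0 (2 * a%:~R * x + h%:~R * y : R).
    by have := sqr_ge0 y; nra.
  have := pos x1 y1; have := pos x2 y2.
  rewrite (pmulr_lge0 _ Q1) (nmulr_lge0 _ Q2) => H1 H2.
  by move: a0; rewrite eq_le H1 H2.
pose s := Num.sqrt D; have s0 : 0 < s by rewrite sqrtr_gt0.
have s2 : s ^+ 2 = D by rewrite sqr_sqrtr // ltW.
have a2 : 2 * a%:~R != 0 :> R by rewrite mulf_neq0 // pnatr_eq0.
exists ((- h%:~R + s) / (2 * a%:~R)), ((- h%:~R - s) / (2 * a%:~R)); split.
  by move=> /(mulIf (invr_neq0 a2)); lra.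
have rootE x r : x = r / (2 * a%:~R) <-> 2 * a%:~R * x = r :> R.
  by split=> [->|<-]; [rewrite mulrC divfK|rewrite mulrC mulKf].
move=> x; rewrite !rootE.
have fac : 4 * a%:~R * qform a h b x 1
  = (2 * a%:~R * x - (- h%:~R + s)) * (2 * a%:~R * x - (- h%:~R - s)).
  by rewrite sq -s2; ring.
split=> [Q0|E].
  move/eqP: fac; rewrite Q0 mulr0 eq_sym mulf_eq0 !subr_eq0.
  by case/orP => /eqP; [left|right].
apply: (mulfI (_ : 4 * a%:~R != 0)); first by rewrite mulf_neq0 // pnatr_eq0.
by rewrite fac mulr0; case: E => ->; rewrite subrr ?mul0r ?mulr0.
Qed.

(** A rational root would give an integral zero of the form. *)
Lemma root_irrational (R : realType) (a h b : int) (x : R) :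
  ~ represents_zero a h b -> qform a h b x 1 = 0 -> irrational x.
Proof.
move=> nz Qx [q _ qx]; apply: nz; exists (numq q), (denq q); split.
  by rewrite xpair_eqE negb_and denq_eq0 orbT.
apply/eqP; rewrite -(intr_eq0 R) qform_intr.
have d0 : (denq q)%:~R != 0 :> R by rewrite intr_eq0 denq_eq0.
have xE : (numq q)%:~R = x * (denq q)%:~R by rewrite -qx /ratr divfK.
have -> : qform a h b (numq q)%:~R (denq q)%:~R
  = (denq q)%:~R ^+ 2 * qform a h b x 1 by rewrite xE /qform; ring.
by rewrite Qx mulr0.
Qed.

Lemma definite_neq0 (R : realType) (a h b : int) (x y : R) :
  definite R a h b -> (x, y) != (0, 0) -> qform a h b x y != 0.
Proof. by case=> def /def; [move/gt_eqF ->|move/lt_eqF ->]. Qed.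

Theorem theorem1 (R : realType) (a h b : int)
    (path : RP1 R -> nat -> turn)
    (path_ok : forall xi : RP1 R, path_word xi (path xi)) :
  (definite R a h b ->
     forall xi : RP1 R, Lambda_Q a h b path xi = (2%:E * Lambda path xi)%E)
  /\
  (indefinite R a h b -> ~ represents_zero a h b ->
     exists alphap alpham : R,
       [/\ alphap <> alpham,
           irrational alphap /\ irrational alpham,
           forall x : R, qform a h b x 1 = 0 <-> x = alphap \/ x = alpham,
           (forall xi : RP1 R, xi <> Some alphap -> xi <> Some alpham ->
              Lambda_Q a h b path xi = (2%:E * Lambda path xi)%E)
           /\ (forall xi : RP1 R, xi = Some alphap \/ xi = Some alpham ->
                 Lambda_Q a h b path xi = 0%E)
         & forall xi : RP1 R,
             Lambda_Q a h b path xi <> (2%:E * Lambda path xi)%E <->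
             xi = Some alphap \/ xi = Some alpham]).
Proof.
split=> [def xi|indef nz].
  apply: nonroot_exponent => [//||x _].
    move=> [x [y [xy Q0]]].
    have xyR : (x%:~R, y%:~R) != (0, 0) :> R * R.
      by move: xy; rewrite !xpair_eqE !intr_eq0.
    by have := definite_neq0 def xyR; rewrite -qform_intr Q0 eqxx.
  by apply: definite_neq0 => //; rewrite xpair_eqE oner_eq0 andbF.
have [alphap [alpham [ne rootP]]] := indefinite_roots indef nz.
have generic (xi : RP1 R) : xi <> Some alphap -> xi <> Some alpham ->
    Lambda_Q a h b path xi = (2%:E * Lambda path xi)%E.
  move=> xip xim; apply: nonroot_exponent => // x xE; apply/eqP => /rootP.
  by case=> e; [apply: xip|apply: xim]; rewrite xE e.
have exceptional (xi : RP1 R) : xi = Some alphap \/ xi = Some alpham ->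
    Lambda_Q a h b path xi = 0%E /\ (0 < Lambda path xi)%E.
  by case=> ->; apply: root_exponents => //; apply/rootP; [left|right].
exists alphap, alpham; split => //.
- by split; apply: root_irrational nz _; apply/rootP; [left|right].
- by split => // xi /exceptional[].
move=> xi; split=> [neq|/exceptional[-> L0]]; last first.
  have two_gt0 : (0 < 2%:E :> \bar R)%E by rewrite lte_fin.
  by move=> e; have := mule_gt0 two_gt0 L0; rewrite -e ltxx.
have [xip|xip] := pselect (xi = Some alphap); first by left.
by right; apply: contrapT => xim; apply: neq; exact: generic.
Qed.
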